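(* Let $\mathcal I,\mathcal J,\mathcal K\subseteq\tilde P(\mathcal C)$ be such that $\mathcal I$ and $\mathcal J$ are semiproductive and $\mathcal K$ is iso-productive. If for each $X\in\mathcal I\cap P(\mathcal C)$ and each $Y\in\mathcal J\cap P(\mathcal C)$ we have $X\oplus Y\in\mathcal K$, then for each $X\in\mathcal I$ and each $Y\in\mathcal J$ we have $X\times Y\in\mathcal K$.
   Context: $\mathcal C=\{0,1\}^{\mathbb N}$ (with $\mathbb N=\{0,1,2,\dots\}$) is the Cantor space with the metric $d(x,y)=\frac{1}{N(x,y)+1}$ for $x\ne y$, where $N(x,y)=\min\{n: x(n)\neq y(n)\}$, and $d(x,x)=0$; $\mu$ is the product of the uniform probability measures on $\{0,1\}$. For $k\ge1$, $\mathcal C^k$ carries the maximum metric $d_k$ and the product measure $\mu\times\dots\times\mu$; $\mathcal C^k\times\mathcal C^l$ is identified with $\mathcal C^{k+l}$. $\oplus$ is coordinatewise addition modulo 2 on $\mathcal C$, and the induced group operation on $\mathcal C^k$, with zero element $0$; for $A,B\subseteq\mathcal C^k$, $A\oplus B=\{a\oplus b:a\in A,b\in B\}$. $P(A)$ is the power set of $A$, and $\tilde P(\mathcal C)=\bigcup_{k\ge1}P(\mathcal C^k)$. For $\mathcal P\subseteq\tilde P(\mathcal C)$ consider: (1) for all $k,l\ge1$ and each $X\in\mathcal P\cap P(\mathcal C^k)$, if $0$ is the zero element of $\mathcal C^l$, then $X\times\{0\}\in\mathcal P$; (2) for all $k,l\ge1$, each $X\in\mathcal P\cap P(\mathcal C^k)$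 and each bi-Lipschitz measure preserving group isomorphism $\Phi:\mathcal C^k\to\mathcal C^l$, $\Phi[X]\in\mathcal P$. $\mathcal P$ is $0$-productive if it satisfies (1), iso-productive if it satisfies (2), and semiproductive if it satisfies both. *)

(* Defs.v *)
From HB Require Import structures.
From mathcomp Require Import all_boot all_order all_algebra.
From mathcomp Require Import all_classical all_reals all_analysis.
From mathcomp Require Import measurable_realfun ring lra.

Set Implicit Arguments.
Unset Strict Implicit.
Unset Printing Implicit Defensive.

Import Order.TTheory GRing.Theory Num.Theory.
Import numFieldNormedType.Exports.

Local Open Scope classical_set_scope.
Local Open Scope ring_scope.

Definition cantor : Type := nat -> bool.

HB.instance Definition _ := Pointed.on cantor.

Definition cantor_coord (i : nat) : cantor -> bool := fun x => x i.

Definition cantor_gen : set (set cantor) :=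
  \bigcup_i preimage_set_system setT (cantor_coord i) measurable.

Definition cantor_display : measure_display.
Proof. exact: default_measure_display. Qed.

HB.instance Definition _ := @isMeasurable.Build cantor_display cantor
  <<s cantor_gen >> (@sigma_algebra0 _ setT cantor_gen)
  (@sigma_algebraC _ cantor_gen) (@sigma_algebra_bigcup _ setT cantor_gen).

Lemma measurable_cantor_coord i : measurable_fun setT (cantor_coord i).
Proof.
move=> _ B mB; apply: sub_sigma_algebra.
by exists i => //; exists B.
Qed.

Lemma measurable_cantorP d (T : measurableType d) (f : T -> cantor) :
  (forall i, measurable_fun setT (fun t => f t i)) -> measurable_fun setT f.
Proof.
move=> mf; apply: (measurability cantor_gen) => //.
move=> _ [_ [i _ [B mB <-]] <-]; rewrite setTI.
exact: mf.
Qed.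

Definition cylinder (n : nat) (A : nat -> set bool) : set cantor :=
  [set x | forall i, (i < n)%N -> A i (x i)].

Lemma cylinderE n A :
  cylinder n A = \bigcap_(i in `I_n) (cantor_coord i @^-1` A i).
Proof. by apply/seteqP; split=> x /= xA i; exact: xA. Qed.

Lemma measurable_cylinder n A : measurable (cylinder n A).
Proof.
rewrite cylinderE; apply: bigcap_measurableType => i _.
by rewrite -[_ @^-1` _]setTI; exact: measurable_cantor_coord.
Qed.

Definition is_uniform_product (R : realType) (P : probability cantor R) :=
  forall n (A : nat -> set bool),
    P (cylinder n A) = (\prod_(i < n) bernoulli_prob 2^-1 (A i))%E.

Section existence.
Variable R : realType.

(* [bits t] is the binary expansion of [t] in [0, 1[; the product measure is
   obtained as the distribution of [bits] under the uniform law. *)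
Let shift (t : R) : R := if t < 2^-1 then 2 * t else 2 * t - 1.
Let bits (t : measurableTypeR R) : cantor := fun n => 2^-1 <= iter n shift t.

Let measurable_shift : measurable_fun setT (shift : measurableTypeR R -> measurableTypeR R).
Proof.
apply: measurable_fun_ifT => //.
- by apply: measurable_fun_ltr.
- by apply: measurable_funB.
Qed.

Let measurable_bits : measurable_fun setT bits.
Proof.
apply: measurable_cantorP => i; apply: measurable_fun_ler => //.
elim: i => [|i IHi]; first exact: measurable_id.
exact: (measurableT_comp measurable_shift IHi).
Qed.

HB.instance Definition _ := isMeasurableFun.Build _ _ _ _ bits measurable_bits.

Let coin : probability cantor R := distribution (uniform_prob (@ltr01 R)) bits.

Let lo (s : seq bool) : R := foldr (fun (b : bool) r => (b%:R + r) / 2) 0 s.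

Let lo_ge0 s : 0 <= lo s.
Proof. by elim: s => //= b s IH; rewrite divr_ge0 // addr_ge0. Qed.

Let lo_le s : lo s + 2^-1 ^+ size s <= 1.
Proof.
elim: s => [|b s IH] /=; first by rewrite add0r expr0.
rewrite exprS; have : (b%:R : R) <= 1 by case: b.
lra.
Qed.

Let bits_itv s (t : R) : 0 <= t < 1 ->
  (forall i, (i < size s)%N -> bits t i = nth false s i) <->
  (lo s <= t < lo s + 2^-1 ^+ size s).
Proof.
elim: s t => [|b s IH] t t01 /=.
  by rewrite add0r expr0; split.
have shift01 : 0 <= shift t < 1.
  by rewrite /shift; case: ltP => ?; lra.
have bS i : bits t i.+1 = bits (shift t) i by rewrite /bits iterSr.
have -> : (forall i, (i < (size s).+1)%N -> bits t i = nth false (b :: s) i) <->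
   (bits t 0 = b /\ forall i, (i < size s)%N -> bits (shift t) i = nth false s i).
  split=> [H|[H0 H] [|i] //]; last by rewrite ltnS bS => /H.
  by split=> [|i si]; [exact: (H 0%N)|rewrite -bS; exact: (H i.+1)].
rewrite IH //; rewrite /bits/= /shift exprS.
have := lo_ge0 s; have := lo_le s.
case: ltP => t2; case: b => /=; split;
  by [lra|case=> //; lra|move=> ?; split=> //; lra].
Qed.


Let coin_string s :
  coin (cylinder (size s) (fun i => [set nth false s i])) = (2^-1 ^+ size s)%:E.
Proof.
rewrite /coin/= /distribution /pushforward /=.
set S := _ @^-1` _.
have mS : measurable S.
  by rewrite /S -[_ @^-1` _]setTI; apply: measurable_bits => //; exact: measurable_cylinder.
rewrite /uniform_prob integral_uniform_pdf.
rewrite (eq_integral (cst 1%:E)); last first.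
  by move=> x /set_mem[_ /=]; rewrite in_itv/= /uniform_pdf => ->; rewrite subr0 invr1.
have mS01 : measurable (S `&` `[0, 1]%classic) by exact: measurableI.
rewrite integral_cst // mul1e.
have -> : S `&` `[0, 1]%classic =
    `[lo s, lo s + 2^-1 ^+ size s[%classic `|` S `&` [set 1].
  have lo0 := lo_ge0 s; have lo1 := lo_le s.
  apply/seteqP; split=> t /=; rewrite !in_itv/=.
    move=> [St t01]; have [t1|t1] := eqVneq t 1; [by right|left].
    have tb : 0 <= t < 1 by lra.
    by have [+ _] := @bits_itv s t tb; apply.
  move=> [tlo|[St t1]]; last by split=> //; rewrite t1; lra.
  have tb : 0 <= t < 1 by lra.
  by split; [have [_] := @bits_itv s t tb; exact|lra].
have mS1 : measurable (S `&` [set 1]) by exact: measurableI.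
rewrite measureU0 //; last first.
  apply: (subset_measure0 mS1 (measurable_set1 1)); first exact: subIsetr.
  exact: lebesgue_measure_set1.
apply: etrans (lebesgue_measure_itv `[lo s, lo s + 2^-1 ^+ size s[) _.
rewrite /= lte_fin ltrDl exprn_gt0 ?invr_gt0 //.
by rewrite -EFinB addrAC subrr add0r.
Qed.


Let coin_split s (A : nat -> set bool) m :
  coin [set x | (forall i, (i < size s)%N -> x i = nth false s i) /\
     (forall i, (size s <= i < size s + m)%N -> A i (x i))] =
  ((2^-1 ^+ size s)%:E *
    \prod_(size s <= i < size s + m) bernoulli_prob 2^-1 (A i))%E.
Proof.
elim: m s => [|m IHm] s.
  rewrite addn0 big_geq // mule1 -coin_string; congr (coin _).
  apply/seteqP; split=> x /=; first by case.
  by move=> sx; split=> // i /andP[] /leq_ltn_trans/[apply]; rewrite ltnn.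
pose B b := [set x : cantor | (forall i, (i < size (rcons s b))%N -> x i = nth false (rcons s b) i) /\
     (forall i, (size (rcons s b) <= i < size (rcons s b) + m)%N -> A i (x i))].
set C := (X in coin X).
pose C' b : set cantor := if b \in A (size s) then B b else set0.
have nthb b : nth false (rcons s b) (size s) = b by rewrite nth_rcons ltnn eqxx.
have mB b : measurable (B b).
  have -> : B b = cylinder (size (rcons s b) + m) (fun i =>
      if (i < size (rcons s b))%N then [set nth false (rcons s b) i] else A i).
    apply/seteqP; split=> x /=.
      move=> [Bx1 Bx2] i im; case: ltnP => is_; first exact: Bx1.
      by apply: Bx2; rewrite is_.
    move=> Bx; split=> i.
      by move=> is_; have := Bx i (leq_trans is_ (leq_addr _ _)); rewrite is_.
    by move=> /andP[is_ im]; have := Bx i im; rewrite ltnNge is_.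
  exact: measurable_cylinder.
have mC' b : measurable (C' b) by rewrite /C'; case: ifP.
have CE : C = C' false `|` C' true.
  apply/seteqP; split=> x.
    move=> [Cx1 Cx2].
    have Ax : A (size s) (x (size s)) by apply: Cx2; rewrite leqnn addnS ltnS leq_addr.
    have : C' (x (size s)) x.
      rewrite /C' mem_set //; split=> i; rewrite size_rcons.
        rewrite ltnS leq_eqVlt => /orP[/eqP ->|is_]; first by rewrite nthb.
        by rewrite nth_rcons is_ Cx1.
      by move=> /andP[is_ im]; apply: Cx2; rewrite ltnW //= addnS -addSn.
    by case: (x (size s)); [right|left].
  have C'C b : C' b `<=` C.
    rewrite /C'; case: ifPn => [/set_mem bA|_] // {}x [Bx1 Bx2]; split=> i is_.
      have := Bx1 i; rewrite size_rcons ltnS ltnW // => /(_ isT) ->.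
      by rewrite nth_rcons is_.
    have [->|ns] := eqVneq i (size s).
      by have := Bx1 (size s); rewrite size_rcons leqnn nthb => /(_ isT) ->.
    apply: Bx2; rewrite size_rcons addSn -addnS.
    by case/andP: is_; rewrite leq_eqVlt eq_sym (negbTE ns) /= => -> ->.
  by case; exact: C'C.
have C'0 : C' false `&` C' true = set0.
  apply/seteqP; split=> x //= -[].
  rewrite /C'; do 2!case: ifP => // _; move=> [F _] [T _].
  have := F (size s); have := T (size s).
  by rewrite !nthb !size_rcons !leqnn => -> // /(_ isT).
have PC' b : coin (C' b) =
   ((2^-1 ^+ (size s).+1)%:E * (b \in A (size s))%:R%:E *
    \prod_((size s).+1 <= i < size s + m.+1) bernoulli_prob 2^-1 (A i))%E.
  rewrite /C'; case: ifP => _; last by rewrite measure0 mule0 mul0e.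
  by rewrite mule1 IHm size_rcons addSn addnS.
have -> : coin C = (coin (C' false) + coin (C' true))%E.
  by rewrite CE; exact: measureU.
rewrite !PC'.
rewrite [in RHS]big_ltn ?addnS ?ltnS ?leq_addr //.
set Q := (\prod_(_ <= _ < _) _)%E.
have [q qE] : exists q, Q = q%:E.
  rewrite /Q; apply: (big_ind (fun z => exists q, z = q%:E)); first by exists 1.
    by move=> _ _ [x ->] [y ->]; exists (x * y).
  move=> i _; exists (fine (bernoulli_prob 2^-1 (A i))).
  by rewrite fineK // fin_num_measure.
have bE (D : set bool) : bernoulli_prob 2^-1 D =
    (((false \in D)%:R + (true \in D)%:R) / 2 : R)%:E.
  have p0 : 0 <= 2^-1 :> R by rewrite invr_ge0.
  have p1 : (NngNum p0)%:num <= 1 by rewrite /=; lra.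
  rewrite (bernoulli_dirac p1) measure_addE /mscale/= /mscale/= !diracE -!EFinM -EFinD.
  by congr (_%:E); set a := _%:R; set b := _%:R; lra.
rewrite bE qE -!EFinM -EFinD; congr (_%:E); rewrite exprS.
by set a := _%:R; set b := _%:R; ring.
Qed.

Lemma uniform_product_exists : exists P : probability cantor R, is_uniform_product P.
Proof.
exists coin => n A; have := coin_split [::] A n.
rewrite expr0 mul1e add0n big_mkord => <-; congr (coin _).
apply/seteqP; split=> x /=; first by move=> xA; split=> // i /=; exact: xA.
by move=> [_ xA] i im; exact: xA.
Qed.

End existence.

(* Characterized by [cantor_measureP], and uniquely so on measurable sets by
   [cantor_measure_unique]. *)
Definition cantor_measure (R : realType) : probability cantor R :=
  sval (cid (uniform_product_exists R)).

Lemma cantor_measureP (R : realType) : is_uniform_product (cantor_measure R).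
Proof. exact: svalP. Qed.

Lemma cantor_measure_unique (R : realType) (P Q : probability cantor R) :
  is_uniform_product P -> is_uniform_product Q ->
  forall B, measurable B -> P B = Q B.
Proof.
move=> HP HQ; pose G := [set C | exists n A, C = cylinder n A].
have GE : measurable = <<s G >>.
  apply/seteqP; split.
    apply: smallest_sub; first exact: smallest_sigma_algebra.
    move=> _ [i _ [B mB <-]]; apply: sub_sigma_algebra.
    exists i.+1, (fun j => if j == i then B else setT).
    rewrite setTI; apply/seteqP; split=> x /=.
      by move=> xB j _; case: eqP => // ->.
    by move=> /(_ i (leqnn _)); rewrite eqxx.
  apply: smallest_sub; first exact: sigma_algebra_measurable.
  by move=> _ [n [A ->]]; exact: measurable_cylinder.
apply: (measure_unique G (fun=> setT) GE).
- move=> _ _ [n [A ->]] [m [B ->]].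
  exists (maxn n m), (fun i => (if (i < n)%N then A i else setT) `&`
                           (if (i < m)%N then B i else setT)).
  apply/seteqP; split=> x /=.
    move=> [xA xB] i _; split; case: ifP => // im; [exact: xA|exact: xB].
  move=> xAB; split=> i im.
    by have := (xAB i); rewrite leq_max im => /(_ isT) [].
  by have := (xAB i); rewrite leq_max im orbT => /(_ isT) [].
- by move=> _; exists 0%N, (fun=> setT); apply/seteqP; split.
- by rewrite bigcup_const //; exists 0%N.
- by move=> _ [n [A ->]]; exact: etrans (HP n A) (esym (HQ n A)).
- by move=> _; rewrite /= probability_setT ltry.
Qed.

Definition cantor_cons (k : nat) (p : cantor * k.-tuple cantor) :
  k.+1.-tuple cantor := [tuple of p.1 :: p.2].

Lemma measurable_cantor_cons k : measurable_fun setT (@cantor_cons k).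
Proof. exact: measurable_cons. Qed.

HB.instance Definition _ k :=
  isMeasurableFun.Build _ _ _ _ (@cantor_cons k) (@measurable_cantor_cons k).

(* [mu x ... x mu] built from the binary product of measures, the point mass on
   the one-point power C^0 being neutral; see [cantor_power_measureE]. *)
Fixpoint cantor_power_measure (R : realType) (k : nat) :
    probability (k.-tuple cantor) R :=
  if k is k'.+1 then
    distribution (cantor_measure R \x cantor_power_measure R k')%E (@cantor_cons k')
  else dirac [tuple].

Lemma cantor_power_measureE (R : realType) k (A : 'I_k -> set cantor) :
  (forall i, measurable (A i)) ->
  cantor_power_measure R k [set x | forall i, A i (tnth x i)] =
  (\prod_(i < k) cantor_measure R (A i))%E.
Proof.
elim: k A => [|k IHk] A mA.
  by rewrite big_ord0 /= diracE mem_set // => -[].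
pose B : set (k.-tuple cantor) :=
  [set y | forall i, A (lift ord0 i) (tnth y i)].
have mB : measurable B.
  have -> : B = \bigcap_(i : 'I_k) ((fun x => tnth x i) @^-1` A (lift ord0 i)).
    by apply/seteqP; split=> x xB i; [move=> _; exact: xB|exact: (xB i I)].
  apply: fin_bigcap_measurable => // i _.
  by rewrite -[_ @^-1` _]setTI; exact: measurable_tnth.
rewrite big_ord_recl -IHk; last by move=> i; exact: mA.
rewrite -/B; apply: etrans (product_measure1E _ _ (mA ord0) mB).
rewrite /= /distribution /pushforward; congr (_ _).
apply/seteqP; split=> -[x y] /=.
  move=> xyA; split=> [|i]; first exact: (xyA ord0).
  by have := xyA (lift ord0 i); rewrite /cantor_cons/= tnthS.
move=> [xA yA] i; case: (unliftP ord0 i) => [j ->|-> //].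
by rewrite /cantor_cons/= tnthS; exact: yA.
Qed.

Definition cantor_dist (R : realType) (x y : cantor) : R :=
  match pselect (exists n, x n != y n) with
  | left xy => (ex_minn xy).+1%:R^-1
  | right _ => 0
  end.

Lemma cantor_dist_first (R : realType) (x y : cantor) n :
  x n != y n -> (forall m, (m < n)%N -> x m = y m) ->
  cantor_dist R x y = n.+1%:R^-1.
Proof.
move=> xyn xym; rewrite /cantor_dist; case: pselect => [h|[]]; last by exists n.
case: ex_minnP => m xm minm; congr (_.+1%:R^-1).
apply/eqP; rewrite eqn_leq minm //= leqNgt.
by apply: contra xm => /xym ->.
Qed.

Lemma cantor_distxx (R : realType) (x : cantor) : cantor_dist R x x = 0.
Proof.
by rewrite /cantor_dist; case: pselect => // h; case: (h) => n; case/eqP.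
Qed.

Definition cantor_power_dist (R : realType) (k : nat) (x y : k.-tuple cantor) : R :=
  \big[Num.max/0]_(i < k) cantor_dist R (tnth x i) (tnth y i).

Definition cantor_add (x y : cantor) : cantor := fun n => x n (+) y n.

Definition cantor_zero : cantor := fun=> false.

Definition seq_add (x y : seq cantor) : seq cantor :=
  [seq cantor_add p.1 p.2 | p <- zip x y].

Definition tuple_add (k : nat) (x y : k.-tuple cantor) : k.-tuple cantor :=
  [tuple of seq_add x y].

Definition bilipschitz (R : realType) (k l : nat)
    (f : k.-tuple cantor -> l.-tuple cantor) :=
  exists2 L : R, 0 < L &
    forall x y, L^-1 * cantor_power_dist R x y <= cantor_power_dist R (f x) (f y)
                <= L * cantor_power_dist R x y.

Definition measure_preserving (R : realType) (k l : nat)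
    (f : k.-tuple cantor -> l.-tuple cantor) :=
  measurable_fun setT f /\
  forall B, measurable B ->
    cantor_power_measure R k (f @^-1` B) = cantor_power_measure R l B.

Definition group_iso (k l : nat) (f : k.-tuple cantor -> l.-tuple cantor) :=
  bijective f /\ {morph f : x y / tuple_add x y}.

(** The power C^k is the set of sequences of length [k]; thus all powers live in the
one type [seq cantor], the empty set is shared by all of them, [C] is [C^1] and
the identification of [C^k * C^l] with [C^(k+l)] is concatenation. *)

Definition cantor_power (k : nat) : set (seq cantor) := [set s | size s = k].

Definition Ptilde : set (set (seq cantor)) :=
  \bigcup_(k in [set k | (0 < k)%N]) [set X | X `<=` cantor_power k].

Definition set_prod (X Y : set (seq cantor)) : set (seq cantor) :=
  [set x ++ y | x in X & y in Y].

Definition set_oplus (X Y : set (seq cantor)) : set (seq cantor) :=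
  [set seq_add x y | x in X & y in Y].

Definition power_image (k l : nat) (f : k.-tuple cantor -> l.-tuple cantor)
    (X : set (seq cantor)) : set (seq cantor) :=
  [set tval (f x) | x in [set x : k.-tuple cantor | X (tval x)]].

Definition zero_productive (P : set (set (seq cantor))) :=
  forall k l : nat, (0 < k)%N -> (0 < l)%N ->
  forall X, P X -> X `<=` cantor_power k ->
    P (set_prod X [set nseq l cantor_zero]).

Definition iso_productive (R : realType) (P : set (set (seq cantor))) :=
  forall k l : nat, (0 < k)%N -> (0 < l)%N ->
  forall X, P X -> X `<=` cantor_power k ->
  forall f : k.-tuple cantor -> l.-tuple cantor,
    bilipschitz R f -> measure_preserving R f -> group_iso f ->
    P (power_image f X).

Definition semiproductive (R : realType) (P : set (set (seq cantor))) :=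
  zero_productive P /\ iso_productive R P.

(* Main.v *)
From HB Require Import structures.
Require Import Defs.
From mathcomp Require Import all_boot all_order all_algebra.
From mathcomp Require Import all_classical all_reals all_analysis.

(** Let X in I lie in C^k, let Y in J lie in C^l, and put n = k + l.  Inside the
group C^n the product X * Y is the sum of the two pieces X * {0} and {0} * Y on
the coordinate axes ([set_oplus_axes]).  The first piece is in I because I is
0-productive.  The second is in J: Y * {0} is, and exchanging the two blocks of
coordinates is an admissible isomorphism of C^n ([power_image_swap]).

For n > 0 there is an admissible isomorphism phi from C^n onto C, namely
interleaving: phi(x) lists first the bits x_i(0) for i < n, then the bits
x_i(1), and so on.  So phi[X * {0}] is in I, phi[{0} * Y] is in J, both are
subsets of C, and their sum phi[X * Y] ([set_oplus_image]) is in K by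
hypothesis.  Applying the inverse of phi gives X * Y in K.

The block exchange, the interleaving and its inverse all permute the bits of a
point, so they are treated together.  A bit of a point of C^k is addressed by a
position (i, p), coordinate i and depth p, and a bijection b between the
positions of C^l and those of C^k induces a map [relabel b] from C^k to C^l.
Such a map is always a group isomorphism, and it always preserves the measure
([relabel_measure_preserving]): it permutes the factors of a product of coin
tosses.  It is bi-Lipschitz as soon as b and its inverse multiply depths, counted
from 1, by a bounded factor ([relabel_bilipschitz]), because two points are at
distance 1/(p+1) where p is the least depth at which they differ.  For
interleaving that factor is n. *)

Set Implicit Arguments.
Unset Strict Implicit.
Unset Printing Implicit Defensive.

Import Order.TTheory GRing.Theory Num.Theory.

Local Open Scope classical_set_scope.

(** * Maps between powers of C that relabel bits *)

Definition position (k : nat) : Type := ('I_k * nat)%type.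

HB.instance Definition _ k := Equality.on (position k).

Definition bit k (x : k.-tuple cantor) (q : position k) : bool := tnth x q.1 q.2.

Lemma bit_inj k (x y : k.-tuple cantor) : bit x =1 bit y -> x = y.
Proof.
by move=> xy; apply: eq_from_tnth => i; apply/funext => p; exact: (xy (i, p)).
Qed.

Lemma bit_add k (x y : k.-tuple cantor) q :
  bit (tuple_add x y) q = bit x q (+) bit y q.
Proof.
rewrite /bit !(tnth_nth cantor_zero) /=.
rewrite /seq_add (nth_map (cantor_zero, cantor_zero)).
  by rewrite nth_zip //= !size_tuple.
by rewrite size_zip !size_tuple minnn.
Qed.

(** Contravariant: [b] says from which position of the source each bit of the
image is read. *)
Definition relabel k l (b : position l -> position k) (x : k.-tuple cantor) :
  l.-tuple cantor := [tuple (fun m => bit x (b (j, m))) : cantor | j < l].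

Lemma bit_relabel k l (b : position l -> position k) x q :
  bit (relabel b x) q = bit x (b q).
Proof. by rewrite {1}/bit /relabel tnth_mktuple -surjective_pairing. Qed.

Lemma relabelK k l (b : position l -> position k) c :
  cancel c b -> cancel (relabel b) (relabel c).
Proof. by move=> cb x; apply: bit_inj => q; rewrite !bit_relabel cb. Qed.

Lemma relabel_add k l (b : position l -> position k) :
  {morph relabel b : x y / tuple_add x y}.
Proof.
by move=> x y; apply: bit_inj => q; rewrite !(bit_relabel, bit_add).
Qed.

Lemma relabel_group_iso k l (b : position l -> position k) :
  bijective b -> group_iso (relabel b).
Proof.
case=> c bK cK; split; last exact: relabel_add.
by exists (relabel c); exact: relabelK.
Qed.

(** * Distances under relabelling *)

Section distance.
Variable R : realType.
Local Open Scope ring_scope.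

Lemma cantor_dist_ge (x y : cantor) n :
  x n != y n -> n.+1%:R^-1 <= cantor_dist R x y.
Proof.
move=> xyn; rewrite /cantor_dist; case: pselect => [h|[]]; last by exists n.
by case: ex_minnP => m _ /(_ n xyn) mn; rewrite lef_pV2 ?posrE // ler_nat.
Qed.

Lemma cantor_dist_le (x y : cantor) (r : R) : 0 <= r ->
  (forall n, x n != y n -> n.+1%:R^-1 <= r) -> cantor_dist R x y <= r.
Proof.
move=> r0 xyr; rewrite /cantor_dist; case: pselect => // h.
by case: ex_minnP => m xym _; exact: xyr.
Qed.

Lemma cantor_power_dist_ge0 k (x y : k.-tuple cantor) :
  0 <= cantor_power_dist R x y.
Proof. by rewrite /cantor_power_dist; apply: bigmax_ge_id. Qed.

Lemma cantor_power_dist_ge k (x y : k.-tuple cantor) q :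
  bit x q != bit y q -> q.2.+1%:R^-1 <= cantor_power_dist R x y.
Proof.
move=> xyq; apply: (le_trans (cantor_dist_ge xyq)).
exact: (le_bigmax _ (fun i => cantor_dist R (tnth x i) (tnth y i))).
Qed.

Lemma cantor_power_dist_le k (x y : k.-tuple cantor) (r : R) : 0 <= r ->
  (forall q, bit x q != bit y q -> q.2.+1%:R^-1 <= r) ->
  cantor_power_dist R x y <= r.
Proof.
move=> r0 xyr; apply: bigmax_le => // i _; apply: cantor_dist_le => // n.
exact: (xyr (i, n)).
Qed.

(** If the images differ at depth m, then the points differ at a depth p with
p + 1 <= L (m + 1), so they are at distance at least 1/(p+1) >= 1/(L (m+1)). *)
Lemma relabel_dist_le k l (b : position l -> position k) (L : nat) :
  (forall q, ((b q).2 < L * q.2.+1)%N) -> forall x y,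
  cantor_power_dist R (relabel b x) (relabel b y)
    <= L%:R * cantor_power_dist R x y.
Proof.
move=> bL x y; apply: cantor_power_dist_le.
  by rewrite mulr_ge0 // cantor_power_dist_ge0.
move=> q; rewrite !bit_relabel => /cantor_power_dist_ge xyd.
apply: (le_trans _ (ler_wpM2l (ler0n _ L) xyd)).
by rewrite ler_pdivlMr // mulrC ler_pdivrMr // -natrM ler_nat.
Qed.

(** The lower bound is the upper bound for the inverse relabelling. *)
Lemma relabel_bilipschitz k l (b : position l -> position k) c (L : nat) :
  (0 < L)%N -> cancel c b ->
  (forall q, ((b q).2 < L * q.2.+1)%N) ->
  (forall q, ((c q).2 < L * q.2.+1)%N) ->
  bilipschitz R (relabel b).
Proof.
move=> L0 cK bL cL; exists L%:R; first by rewrite ltr0n.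
move=> x y; rewrite relabel_dist_le // andbT mulrC ler_pdivrMr ?ltr0n // mulrC.
by have := relabel_dist_le cL (relabel b x) (relabel b y); rewrite !relabelK.
Qed.

End distance.

(** * Measures under relabelling *)

(** Two finite lists of factors have the same product if they differ only by
neutral factors.  This frees the measure of a box from the choice of the finite
set of positions outside which its constraints are trivial. *)
Lemma eq_big_support (T : eqType) (idx : T) (op : Monoid.com_law idx)
    (I : eqType) (r s : seq I) (F : I -> T) : uniq r -> uniq s ->
  (forall i, (i \in r) != (i \in s) -> F i = idx) ->
  \big[op/idx]_(i <- r) F i = \big[op/idx]_(i <- s) F i.
Proof.
move=> ur us rs.
have drop (t : seq I) : \big[op/idx]_(i <- t) F i =
    \big[op/idx]_(i <- [seq i <- t | F i != idx]) F i.
  rewrite big_filter (bigID (fun i => F i == idx)) /= big1 ?Monoid.mul1m //.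
  by move=> i /eqP.
rewrite drop [RHS]drop; apply: perm_big.
apply: uniq_perm; rewrite ?filter_uniq //.
move=> i; rewrite !mem_filter; case: eqP => //= Fi.
by apply/eqP/negPn/negP => /rs.
Qed.

(** Constraints are indexed by all positions at once, rather than by coordinate
and then depth, so that relabelling merely permutes them. *)
Definition box k (A : position k -> set bool) : set (k.-tuple cantor) :=
  [set x | forall q, A q (bit x q)].

Definition boxes k : set (set (k.-tuple cantor)) :=
  [set B | exists (A : position k -> set bool) (s : seq (position k)),
    (forall q, q \notin s -> A q = setT) /\ B = box A].

Lemma relabel_box k l (b : position l -> position k) c
    (A : position l -> set bool) :
  cancel b c -> cancel c b -> relabel b @^-1` box A = box (A \o c).
Proof.
move=> bK cK; apply/seteqP; split=> x /= xA q.
  by have := xA (c q); rewrite bit_relabel cK.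
by have := xA (b q); rewrite /= bit_relabel bK.
Qed.

Lemma measurable_bit k q : measurable_fun setT (@bit k ^~ q).
Proof.
exact: (measurableT_comp (measurable_cantor_coord q.2) (measurable_tnth q.1)).
Qed.

Lemma measurable_relabel k l (b : position l -> position k) :
  measurable_fun setT (relabel b).
Proof.
apply/measurable_fun_tnthP => j; apply: measurable_cantorP => m.
rewrite [X in measurable_fun _ X](_ : _ = @bit k ^~ (b (j, m))).
  exact: measurable_bit.
by apply/funext => x; exact: (bit_relabel b x (j, m)).
Qed.

HB.instance Definition _ k l (b : position l -> position k) :=
  isMeasurableFun.Build _ _ _ _ (relabel b) (@measurable_relabel k l b).

Section measure.
Variable R : realType.

(** The measure of a box is the product, over any finite set of positions
carrying its constraints, of the probabilities of the single constraints. *)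
Lemma box_measureE k (A : position k -> set bool) (s : seq (position k)) :
  uniq s ->
  (forall q, q \notin s -> A q = setT) ->
  cantor_power_measure R k (box A) =
  (\prod_(q <- s) bernoulli_prob (2^-1)%R (A q))%E.
Proof.
move=> us sA.
(* All constraints sit at depth less than N, so the box is a product of
   cylinders of length N. *)
pose N := (\max_(q <- s) q.2.+1)%N.
have NA0 q : q \in s -> (q.2 < N)%N.
  by move=> qs; exact: (leq_bigmax_seq (F := fun q : position k => q.2.+1)).
have NA q : (N <= q.2)%N -> A q = setT.
  move=> Nq; apply: sA; apply: contraL Nq => qs; rewrite -ltnNge.
  exact: NA0.
have -> : box A = [set x | forall i : 'I_k,
    cylinder N (fun p => A (i, p)) (tnth x i)].
  apply/seteqP; split=> x /= xA; first by move=> i p _; exact: (xA (i, p)).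
  move=> [i p]; have [pN|Np] := ltnP p N; first exact: xA.
  by rewrite NA.
rewrite (@cantor_power_measureE R k
  (fun i => cylinder N (fun p => A (i, p)))); last first.
  by move=> i; exact: measurable_cylinder.
have row i : cantor_measure R (cylinder N (fun p => A (i, p))) =
    (\prod_(p <- index_iota 0 N) bernoulli_prob (2^-1)%R (A (i, p)))%E.
  rewrite (cantor_measureP R N (fun p => A (i, p))).
  by rewrite big_mkord.
rewrite (eq_bigr _ (fun i _ => row i)).
rewrite -(big_allpairs
  (F := fun q : position k => bernoulli_prob (2^-1)%R (A q))).
apply: eq_big_support => //.
  apply: allpairs_uniq; rewrite ?index_enum_uniq ?iota_uniq //.
  by move=> [? ?] [? ?].
move=> [i p].
have -> : ((i, p) \in [seq (j, m) | j <- index_enum 'I_k, m <- index_iota 0 N])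
    = (p < N)%N.
  apply/idP/idP => [/allpairsP[[j m] /= [_ + [_ ->]]]|pN].
    by rewrite mem_iota subn0.
  apply/allpairsP; exists (i, p).
  by rewrite /= mem_index_enum mem_iota add0n subn0.
case: (boolP ((i, p) \in s)) => [ips|/sA -> _]; last exact: probability_setT.
by move: (NA0 _ ips) => /= ->.
Qed.

(** The coordinates of C^k, and the bits of each coordinate, generate the
sigma-algebra; so it suffices that every single bit is measurable for the
sigma-algebra generated by the boxes, i.e. that the identity is measurable. *)
Lemma boxes_generate k : @measurable _ (k.-tuple cantor) = <<s @boxes k >>.
Proof.
apply/seteqP; split; last first.
  apply: smallest_sub; first exact: sigma_algebra_measurable.
  move=> _ [A [s [sA ->]]].
  have -> : box A = \big[setI/setT]_(q <- s) (@bit k ^~ q @^-1` A q).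
    apply/seteqP; split=> x /=; rewrite -bigcap_seq /=.
      by move=> xA q _; exact: xA.
    move=> xA q; case: (boolP (q \in s)) => [/xA//|/sA ->//].
  apply: bigsetI_measurable => q _.
  by rewrite -[_ @^-1` _]setTI; exact: measurable_bit.
have idm : @measurable_fun _ _ (g_sigma_algebraType (@boxes k))
    (k.-tuple cantor) setT id.
  apply/measurable_fun_tnthP => i; apply: measurable_cantorP => p _ B _.
  rewrite setTI; apply: sub_sigma_algebra.
  exists (fun q => if q == (i, p) then B else setT), [:: (i, p)]; split.
    by move=> q; rewrite inE => /negbTE ->.
  apply/seteqP; split=> x /=.
    by move=> xB q; case: eqP => // ->.
  by move=> /(_ (i, p)); rewrite eqxx.
by move=> B mB; have := idm measurableT B mB; rewrite setTI.
Qed.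

Lemma boxesI k : setI_closed (@boxes k).
Proof.
move=> _ _ [A [s [sA ->]]] [B [t [tB ->]]].
exists (fun q => A q `&` B q), (s ++ t); split.
  by move=> q; rewrite mem_cat negb_or => /andP[/sA -> /tB ->]; rewrite setTI.
apply/seteqP; split=> x /=; first by move=> [xA xB] q; split.
by move=> xAB; split=> q; case: (xAB q).
Qed.

(** The push-forward measure and the target measure agree on boxes, whose
preimages are boxes with the same constraints in permuted positions; boxes form
a pi-system generating the sigma-algebra, so the two measures are equal. *)
Lemma relabel_measure_preserving k l (b : position l -> position k) :
  bijective b -> measure_preserving R (relabel b).
Proof.
case=> c bK cK; split; first exact: measurable_relabel.
move=> B mB; symmetry.
apply: (measure_unique (@boxes l) (fun=> setT) _ _ _ _
  (cantor_power_measure R l)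
  (distribution (cantor_power_measure R k) (relabel b))) => //.
- exact: boxes_generate.
- exact: boxesI.
- by move=> _; exists (fun=> setT), [::]; split=> //; apply/seteqP; split.
- by rewrite bigcup_const //; exists 0%N.
- move=> _ [A [s [sA ->]]].
  rewrite /= /distribution /pushforward (relabel_box A bK cK).
  (* The preimage is constrained at the positions b q, for q in s. *)
  rewrite (box_measureE (undup_uniq s)); last first.
    by move=> q; rewrite mem_undup; exact: sA.
  rewrite (@box_measureE _ _ (map b (undup s))); last 2 first.
  + by rewrite map_inj_uniq ?undup_uniq //; exact: can_inj bK.
  + move=> q qs /=; apply: sA; rewrite -mem_undup; apply: contra qs => cqs.
    by rewrite -[q]cK map_f.
  by rewrite big_map; apply: eq_bigr => q _ /=; rewrite bK.
- by move=> _; rewrite /= probability_setT ltry.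
Qed.

End measure.

(** * Images of sets of points *)

Lemma iso_productive_relabel (R : realType) (P : set (set (seq cantor))) k l
    (b : position l -> position k) c (L : nat) (X : set (seq cantor)) :
  iso_productive R P -> (0 < k)%N -> (0 < l)%N -> (0 < L)%N ->
  cancel b c -> cancel c b ->
  (forall q, ((b q).2 < L * q.2.+1)%N) ->
  (forall q, ((c q).2 < L * q.2.+1)%N) ->
  P X -> X `<=` cantor_power k -> P (power_image (relabel b) X).
Proof.
move=> isoP k0 l0 L0 bK cK bL cL PX Xk.
apply: isoP k0 l0 _ PX Xk _ _ _ _.
- exact: relabel_bilipschitz L0 cK bL cL.
- by apply: relabel_measure_preserving; exists c.
- by apply: relabel_group_iso; exists c.
Qed.

Lemma power_image_sub k l (f : k.-tuple cantor -> l.-tuple cantor) X :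
  power_image f X `<=` cantor_power l.
Proof. by move=> _ [x _ <-]; rewrite /cantor_power /= size_tuple. Qed.

Lemma power_imageK k l (f : k.-tuple cantor -> l.-tuple cantor) g X :
  X `<=` cantor_power k -> cancel f g ->
  power_image g (power_image f X) = X.
Proof.
move=> Xk fK; apply/seteqP; split=> [_ [y [x Xx /val_inj <-] <-]|x Xx].
  by rewrite fK.
have xk := Xk _ Xx; rewrite /cantor_power /= in xk.
pose t : k.-tuple cantor := Tuple (introT eqP xk).
by exists (f t); [exists t|rewrite fK].
Qed.

Lemma set_oplus_image k l (f : k.-tuple cantor -> l.-tuple cantor) X Y :
  {morph f : x y / tuple_add x y} ->
  X `<=` cantor_power k -> Y `<=` cantor_power k ->
  set_oplus (power_image f X) (power_image f Y) = power_image f (set_oplus X Y).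
Proof.
move=> fD Xk Yk; apply/seteqP; split.
  move=> _ [_ [x Xx <-] [_ [y Yy <-] <-]].
  exists (tuple_add x y); last by rewrite fD.
  by exists (tval x) => //; exists (tval y).
move=> _ [z [x Xx [y Yy xyz]] <-].
have xk := Xk _ Xx; have yk := Yk _ Yy; rewrite /cantor_power /= in xk yk.
pose u : k.-tuple cantor := Tuple (introT eqP xk).
pose v : k.-tuple cantor := Tuple (introT eqP yk).
have -> : z = tuple_add u v by apply: val_inj.
rewrite fD; exists (tval (f u)); first by exists u.
by exists (tval (f v)) => //; exists v.
Qed.

(** * Interleaving C^n into C *)

(** Bit m of the interleaved sequence is bit m / n of coordinate m mod n.  The
argument [i0] makes n positive, so that m mod n is a coordinate. *)
Definition interleave_pos n (i0 : 'I_n) (q : position 1) : position n :=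
  (insubd i0 (q.2 %% n)%N, (q.2 %/ n)%N).

Definition deinterleave_pos n (q : position n) : position 1 :=
  (ord0, (q.2 * n + q.1)%N).

Lemma interleave_posK n (i0 : 'I_n) :
  cancel (interleave_pos i0) (@deinterleave_pos n).
Proof.
move=> [j m]; have n0 := leq_ltn_trans (leq0n _) (ltn_ord i0).
rewrite /deinterleave_pos /= val_insubd ltn_pmod //.
by rewrite -divn_eq (ord1 j).
Qed.

Lemma deinterleave_posK n (i0 : 'I_n) :
  cancel (@deinterleave_pos n) (interleave_pos i0).
Proof.
move=> [i p]; have n0 := leq_ltn_trans (leq0n _) (ltn_ord i0).
rewrite /interleave_pos /= modnMDl modn_small // valKd divnMDl //.
by rewrite divn_small // addn0.
Qed.

Lemma interleave_pos_le n (i0 : 'I_n) q :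
  ((interleave_pos i0 q).2 < n * q.2.+1)%N.
Proof.
have n0 := leq_ltn_trans (leq0n _) (ltn_ord i0).
by rewrite /= (leq_ltn_trans (leq_div _ _)) // leq_pmull.
Qed.

Lemma deinterleave_pos_le n (q : position n) :
  ((deinterleave_pos q).2 < n * q.2.+1)%N.
Proof. by rewrite /= mulnS addnC mulnC ltn_add2r. Qed.

(** * Exchanging the two factors of a product *)

Definition swap_ord k l (i : 'I_(k + l)) : 'I_(l + k) :=
  unsplit (match fintype.split i with inl a => inr a | inr b => inl b end).

Lemma swap_ordK k l : cancel (@swap_ord k l) (@swap_ord l k).
Proof.
move=> i; rewrite /swap_ord unsplitK -[RHS]splitK; congr unsplit.
by case: fintype.split.
Qed.

Definition swap_pos k l (q : position (k + l)) : position (l + k) :=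
  (swap_ord q.1, q.2).

Lemma swap_posK k l : cancel (@swap_pos k l) (@swap_pos l k).
Proof. by move=> [i p]; rewrite /swap_pos /= swap_ordK. Qed.

Lemma relabel_swap_cat k l (x : k.-tuple cantor) (y : l.-tuple cantor) :
  relabel (@swap_pos k l) [tuple of y ++ x] = [tuple of x ++ y].
Proof.
apply: bit_inj => -[i p]; rewrite bit_relabel /swap_pos /bit /= /swap_ord.
rewrite -[in RHS](splitK i); case: fintype.split => a /=.
  by rewrite tnth_rshift tnth_lshift.
by rewrite tnth_rshift tnth_lshift.
Qed.

Lemma set_prod_sub k l X Y : X `<=` cantor_power k -> Y `<=` cantor_power l ->
  set_prod X Y `<=` cantor_power (k + l).
Proof.
move=> Xk Yl _ [x /Xk xk [y /Yl yl <-]].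
by rewrite /cantor_power /= size_cat xk yl.
Qed.

Lemma power_image_swap k l X Y : X `<=` cantor_power k -> Y `<=` cantor_power l ->
  power_image (relabel (@swap_pos k l)) (set_prod Y X) = set_prod X Y.
Proof.
move=> Xk Yl; apply/seteqP; split.
  move=> _ [z [y Yy [x Xx xyz]] <-].
  have xk := Xk _ Xx; have yl := Yl _ Yy; rewrite /cantor_power /= in xk yl.
  pose u : k.-tuple cantor := Tuple (introT eqP xk).
  pose v : l.-tuple cantor := Tuple (introT eqP yl).
  have -> : z = [tuple of v ++ u] by apply: val_inj.
  by rewrite relabel_swap_cat; exists x => //; exists y.
move=> _ [x Xx [y Yy <-]].
have xk := Xk _ Xx; have yl := Yl _ Yy; rewrite /cantor_power /= in xk yl.
pose u : k.-tuple cantor := Tuple (introT eqP xk).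
pose v : l.-tuple cantor := Tuple (introT eqP yl).
exists [tuple of v ++ u]; last by rewrite relabel_swap_cat.
by exists y => //; exists x.
Qed.

(** * A product is the sum of its two axes *)

Lemma cantor_addr0 x : cantor_add x cantor_zero = x.
Proof. by apply/funext => n; rewrite /cantor_add addbF. Qed.

Lemma cantor_add0r x : cantor_add cantor_zero x = x.
Proof. by apply/funext => n; rewrite /cantor_add addFb. Qed.

Lemma seq_add0r (x : seq cantor) : seq_add (nseq (size x) cantor_zero) x = x.
Proof.
by elim: x => // a x IH; rewrite /seq_add /= cantor_add0r; congr cons.
Qed.

Lemma seq_addr0 (x : seq cantor) : seq_add x (nseq (size x) cantor_zero) = x.
Proof.
by elim: x => // a x IH; rewrite /seq_add /= cantor_addr0; congr cons.
Qed.

Lemma seq_add_cat (x y x' y' : seq cantor) : size x = size y ->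
  seq_add (x ++ x') (y ++ y') = seq_add x y ++ seq_add x' y'.
Proof. by move=> xy; rewrite /seq_add zip_cat // map_cat. Qed.

Lemma set_oplus_axes k l X Y : X `<=` cantor_power k -> Y `<=` cantor_power l ->
  set_oplus (set_prod X [set nseq l cantor_zero])
            (set_prod [set nseq k cantor_zero] Y) = set_prod X Y.
Proof.
move=> Xk Yl.
have xyE x y : X x -> Y y ->
    seq_add (x ++ nseq l cantor_zero) (nseq k cantor_zero ++ y) = x ++ y.
  move=> /Xk <- /Yl <-.
  by rewrite seq_add_cat ?size_nseq // seq_addr0 seq_add0r.
apply/seteqP; split.
  move=> _ [_ [x Xx [_ -> <-]] [_ [_ -> [y Yy <-]] <-]].
  by rewrite xyE //; exists x => //; exists y.
move=> _ [x Xx [y Yy <-]]; exists (x ++ nseq l cantor_zero).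
  by exists x => //; exists (nseq l cantor_zero).
exists (nseq k cantor_zero ++ y); last exact: xyE.
by exists (nseq k cantor_zero) => //; exists y.
Qed.

Theorem theorem1p6 (R : realType) (I J K : set (set (seq cantor)))
  (subI : I `<=` Ptilde) (subJ : J `<=` Ptilde) (subK : K `<=` Ptilde)
  (semiI : semiproductive R I) (semiJ : semiproductive R J)
  (isoK : iso_productive R K)
  (sumIJ : forall X Y : set (seq cantor),
     I X -> X `<=` cantor_power 1 -> J Y -> Y `<=` cantor_power 1 ->
     K (set_oplus X Y)) :
  forall X Y : set (seq cantor), I X -> J Y -> K (set_prod X Y).
Proof.
move=> X Y IX JY.
have [k k0 Xk] := subI _ IX; have [l l0 Yl] := subJ _ JY.
rewrite /= in k0 l0.
case: semiI => zeroI isoI; case: semiJ => zeroJ isoJ.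
have zero_sub m : [set nseq m cantor_zero] `<=` cantor_power m.
  by move=> _ ->; exact: size_nseq.
pose X0 := set_prod X [set nseq l cantor_zero].
pose Y0 := set_prod [set nseq k cantor_zero] Y.
have X0n : X0 `<=` cantor_power (k + l) by exact: set_prod_sub.
have Y0n : Y0 `<=` cantor_power (k + l) by exact: set_prod_sub.
have IX0 : I X0 by exact: zeroI IX Xk.
have JY0 : J Y0.
  rewrite /Y0 -(power_image_swap (zero_sub k) Yl).
  apply: (iso_productive_relabel (L := 1) isoJ _ _ _
    (@swap_posK k l) (@swap_posK l k)).
  - by rewrite addn_gt0 l0.
  - by rewrite addn_gt0 k0.
  - by [].
  - by move=> q; rewrite mul1n.
  - by move=> q; rewrite mul1n.
  - exact: zeroJ JY Yl.
  - exact: set_prod_sub.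
have n0 : (0 < k + l)%N by rewrite addn_gt0 k0.
pose i0 := Ordinal n0.
pose phi := relabel (interleave_pos i0).
have phiD : {morph phi : x y / tuple_add x y} by exact: relabel_add.
have Kphi : K (power_image phi (set_prod X Y)).
  rewrite -(set_oplus_axes Xk Yl) -set_oplus_image //.
  have to1 P Z : iso_productive R P -> P Z -> Z `<=` cantor_power (k + l) ->
      P (power_image phi Z).
    move=> isoP; apply: (iso_productive_relabel isoP n0 _ n0
      (interleave_posK i0) (deinterleave_posK i0)) => //.
    - exact: interleave_pos_le.
    - exact: deinterleave_pos_le.
  apply: sumIJ; by [exact: to1 | exact: power_image_sub].
have XYn : set_prod X Y `<=` cantor_power (k + l) by exact: set_prod_sub.
rewrite -(power_imageK XYn (relabelK (deinterleave_posK i0))).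
apply: (iso_productive_relabel isoK _ n0 n0
  (deinterleave_posK i0) (interleave_posK i0)) => //.
- exact: deinterleave_pos_le.
- exact: interleave_pos_le.
- exact: power_image_sub.
Qed.
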